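(* For the urn model $R$ with parameters $m,c$ and initial composition $(W_0,B_0)$ described in the context, the number $W_n$ of white balls after $n$ draws satisfies, for all $n\ge 0$, $$\mathbb{E}(W_n)=\frac{W_0}{T_0}(nmc+T_0),$$ and the variance $\mathbb{V}(W_n)=\mathbb{E}(W_n^2)-\mathbb{E}(W_n)^2$ is given in terms of the second moment $$\mathbb{E}(W_n^2)=\frac{\binom{n-1+\mu_1}{n}\binom{n-1+\mu_2}{n}}{\binom{n-1+\frac{T_0}{mc}}{n}^2}\left(W_0^2+\frac{W_0c^2m}{T_0}\sum_{\ell=0}^{n-1}\frac{\binom{\ell+\frac{T_0}{mc}}{\ell+1}^2}{\binom{\ell+\mu_1}{\ell+1}\binom{\ell+\mu_2}{\ell+1}}\right),$$ where $\mu_{1,2}=\dfrac{T_0+mc\pm c\sqrt{m}}{mc}$. For every integer $s\ge 1$ the $s$-th moment satisfies $$\mathbb{E}(W_n^s)=\left(\prod_{j=0}^{n-1}\gamma_{j,s}\right)\left(W_0^s+\sum_{\ell=0}^{n-1}\frac{\delta_{\ell,s}}{\prod_{j=0}^{\ell}\gamma_{j,s}}\right),$$ where $$\gamma_{n,s}=\sum_{\ell=0}^{s}c^\ell\,\frac{\binom{s}{\ell}\,m^{\underline{\ell}}}{T_n^\ell},\qquad \delta_{n,s}=\sum_{j=2}^{s}\mathbb{E}(W_n^{s+1-j})\sum_{\ell=j}^{s}\binom{s}{\ell}c^\ell\,\frac{S(\ell,\ell+1-j)\,m^{\underline{\ell+1-j}}}{T_n^{\ell+1-j}}.$$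
   Context: Urn model $R$: let $m\ge 1$ and $c\ge 1$ be integers. An urn initially contains $W_0$ white and $B_0$ black balls, where $W_0,B_0$ are integers with $W_0>0$, $B_0>0$, and $T_0=W_0+B_0\ge m$. At each discrete time step $m$ balls are drawn one by one uniformly at random with replacement from the urn (each drawn ball is put back after observing its color, before the next is drawn). If $m-\ell$ white balls and $\ell$ black balls have been observed ($0\le\ell\le m$), then $c(m-\ell)$ white balls and $c\ell$ black balls are added to the urn. $W_n$ and $B_n$ denote the numbers of white and black balls after $n$ draws (time steps); the total is $T_n=W_n+B_n=T_0+nmc$. Thus, given the first $n-1$ draws, the probability that the $n$-th sample has exactly $k$ white balls is $\binom{m}{k}W_{n-1}^k(T_{n-1}-W_{n-1})^{m-k}/T_{n-1}^m$, $0\le k\le m$, and then $W_n=W_{n-1}+kc$. Notation: $x^{\underline{\ell}}=x(x-1)\cdots(x-\ell+1)$ with $x^{\underline{0}}=1$ is the falling factorial; for real $x$ and integer $k\ge0$, $\binom{x}{k}=x^{\underline{k}}/k!$; $S(n,k)$ is a Stirling number of the second kind; $T_n^\ell$ is the ordinary $\ell$-th power of $T_n$; empty sums are $0$ and empty products are $1$. *)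

(* Defs.v *)
From HB Require Import structures.
From mathcomp Require Import all_boot all_order all_algebra.
From mathcomp Require Import all_classical all_reals all_analysis.

Set Implicit Arguments.
Unset Strict Implicit.
Unset Printing Implicit Defensive.

Import Order.TTheory GRing.Theory Num.Theory.
Import numFieldNormedType.Exports.

Local Open Scope classical_set_scope.
Local Open Scope ring_scope.

(* S(n, k): the number of partitions of an n-element set into k blocks
   (the blocks of [finset.partition] are nonempty). *)
Definition stirling2 (n k : nat) : nat :=
  #|[pred Q : {set {set 'I_n}} |
       finset.partition Q (finset.setTfor 'I_n) & #|Q| == k]|.

Definition binr (R : realType) (x : R) (k : nat) : R :=
  (\prod_(i < k) (x - i%:R)) / k`!%:R.

(* A colour table [e] records all observed colours: [e j i] is [true] iff the
   i-th ball drawn at time step j + 1 is white (and [false] iff it is black).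
   The composition after n steps only depends on the rows j < n. *)
Section Composition.
Local Open Scope nat_scope.

Fixpoint white (m c W0 : nat) (e : nat -> 'I_m -> bool) (n : nat) : nat :=
  if n is n'.+1 then white c W0 e n' + c * #|[pred i | e n' i]| else W0.

Fixpoint black (m c B0 : nat) (e : nat -> 'I_m -> bool) (n : nat) : nat :=
  if n is n'.+1 then black c B0 e n' + c * #|[pred i | ~~ e n' i]| else B0.

End Composition.

Definition observed (Omega : Type) (m : nat) (X : nat -> 'I_m -> Omega -> bool)
    (e : nat -> 'I_m -> bool) (n : nat) : set Omega :=
  [set w | forall j i, (j < n)%N -> X j i w = e j i].

(* The probability that one ball drawn uniformly from the urn with composition
   after n steps given by [e] has colour [b]. *)
Definition draw_prob (R : realType) (m c W0 B0 : nat)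
    (e : nat -> 'I_m -> bool) (n : nat) (b : bool) : R :=
  (if b then white c W0 e n else black c B0 e n)%:R /
  (white c W0 e n + black c B0 e n)%:R.

(* Conditionally on the colours seen in the first n steps, the m draws of step
   n + 1 (with replacement) are independent and uniform in the current urn.
   The conditional probability is written in multiplied-out form, so that
   histories of probability 0 impose no condition. *)
Definition urn_model_R (R : realType) (d : measure_display)
    (Omega : measurableType d) (P : probability Omega R) (m c W0 B0 : nat)
    (X : nat -> 'I_m -> {RV P >-> bool}) : Prop :=
  forall (n : nat) (e : nat -> 'I_m -> bool),
    P (observed X e n.+1) =
    (P (observed X e n) * (\prod_(i < m) draw_prob R c W0 B0 e n (e n i))%:E)%E.

Definition nb_white (R : realType) (d : measure_display)
    (Omega : measurableType d) (P : probability Omega R) (m c W0 : nat)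
    (X : nat -> 'I_m -> {RV P >-> bool}) (n : nat) (w : Omega) : R :=
  (white c W0 (fun j i => X j i w) n)%:R.

Definition moment (R : realType) (d : measure_display)
    (Omega : measurableType d) (P : probability Omega R) (Y : Omega -> R)
    (k : nat) : \bar R :=
  ('E_P[fun w => (Y w ^+ k)%R])%E.

Definition total_balls (R : realType) (m c T0 n : nat) : R := (T0 + n * m * c)%:R.

Definition mu1 (R : realType) (m c T0 : nat) : R :=
  (T0%:R + m%:R * c%:R + c%:R * Num.sqrt m%:R) / (m%:R * c%:R).

Definition mu2 (R : realType) (m c T0 : nat) : R :=
  (T0%:R + m%:R * c%:R - c%:R * Num.sqrt m%:R) / (m%:R * c%:R).

Definition gamma_coef (R : realType) (m c T0 n s : nat) : R :=
  \sum_(0 <= l < s.+1)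
    c%:R ^+ l * ('C(s, l)%:R * (m ^_ l)%:R / total_balls R m c T0 n ^+ l).

(* [M k] stands for the k-th moment of the number of white balls after n steps;
   only the orders 1 <= k < s occur. *)
Definition delta_coef (R : realType) (m c T0 n s : nat) (M : nat -> R) : R :=
  \sum_(2 <= j < s.+1) M (s + 1 - j)%N *
    \sum_(j <= l < s.+1)
      'C(s, l)%:R * c%:R ^+ l *
      ((stirling2 l (l + 1 - j))%:R * (m ^_ (l + 1 - j))%:R
       / total_balls R m c T0 n ^+ (l + 1 - j)).

(* Main.v *)
(* Condition on the first n steps: with p = W_n / T_n, the number K of white balls
   in the next sample is binomial (m, p). Expanding K^l as a sum over maps
   f : 'I_l -> 'I_m of the events that every ball in the image of f is white, which
   have probability p ^ #|image f|, and sorting the maps by their kernel partition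
   gives E(K^l) = \sum_k S(l,k) m^_k p^k. Hence E(W_{n+1}^s) is gamma_{n,s} E(W_n^s)
   (the terms k = l) plus delta_{n,s} (the terms k = l + 1 - j < l), an affine
   recurrence in n. For s = 2, gamma_{n,2} = (mu1 + n)(mu2 + n) / (T_0/(mc) + n)^2. *)

Require Import Defs.
From mathcomp Require Import all_boot all_order all_algebra.
From mathcomp Require Import all_classical all_reals all_analysis.
From mathcomp Require Import ring zify.

Import Order.TTheory GRing.Theory Num.Theory.
Import numFieldNormedType.Exports.

Local Open Scope classical_set_scope.
Local Open Scope ring_scope.

(** * Counting maps by their kernel partition *)

(** A partition is recovered from the relation of lying in a common block, so equality with the
    kernel partition can be tested on pairs of points. *)
Lemma preim_partition_eqP (D : finType) (T : eqType) (f : D -> T)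
    (Q : {set {set D}}) :
  finset.partition Q (finset.setTfor D) ->
  reflect (forall x y, (f x == f y) = (finset.pblock Q x == finset.pblock Q y))
    (preim_partition f (finset.setTfor D) == Q).
Proof.
move=> hQ; have /and3P[/eqP covQ tiQ nQ] := hQ.
have inQ x : x \in finset.cover Q by rewrite covQ finset.in_setT.
have pbE x y : (finset.pblock Q x == finset.pblock Q y) = (y \in finset.pblock Q x).
  by rewrite finset.eq_pblock.
apply: (iffP eqP) => [fQ x y|hf].
  rewrite pbE -fQ finset.pblock_equivalence_partition ?finset.in_setT//.
  by move=> a b e _ _ _; split=> // /eqP ->.
rewrite -[RHS](finset.equivalence_partition_pblock hQ).
rewrite /preim_partition /finset.equivalence_partition.
apply: finset.eq_imset => x; apply/finset.setP => y.
by rewrite !finset.inE /= hf pbE.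
Qed.

(** A map with kernel [Q] is constant on blocks and separates them: it is an injection on the blocks
    composed with the projection [block]. *)
Lemma card_preim_partition_fiber (D T : finType) (Q : {set {set D}}) :
  finset.partition Q (finset.setTfor D) ->
  #|[set f : {ffun D -> T} | preim_partition f (finset.setTfor D) == Q]%SET|
    = (#|T| ^_ #|Q|)%N.
Proof.
move=> hQ; have /and3P[/eqP covQ tiQ nQ] := hQ.
have pbQ x : finset.pblock Q x \in Q.
  by apply: finset.pblock_mem; rewrite covQ finset.in_setT.
pose I := {B : {set D} | B \in Q}.
pose block x : I := exist _ (finset.pblock Q x) (pbQ x).
have block_surj (B : I) : exists x, block x == B.
  case: B => B BQ.
  have /finset.set0Pn[x xB] : B != finset.set0.
    by apply: contraNneq nQ => <-.
  by exists x; apply/eqP/val_inj => /=; exact: finset.def_pblock.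
pose rep B := xchoose (block_surj B).
have repK B : block (rep B) = B := eqP (xchooseP (block_surj B)).
pose lift (g : {ffun I -> T}) : {ffun D -> T} := [ffun x => g (block x)].
have lift_inj : injective lift.
  move=> g h /ffunP gh; apply/ffunP => B.
  by have := gh (rep B); rewrite !ffunE repK.
have blockE x y : (block x == block y) = (finset.pblock Q x == finset.pblock Q y).
  by [].
transitivity #|finset.imset lift (mem [set g : {ffun I -> T} | injectiveb g]%SET)|.
  apply: eq_card => f; rewrite finset.inE.
  apply/(preim_partition_eqP _ _ f _ hQ)/finset.imsetP => [hf|[g]].
    exists [ffun B => f (rep B)].
      rewrite finset.inE; apply/injectiveP => B C; rewrite !ffunE => /eqP.
      by rewrite hf -blockE !repK => /eqP.
    by apply/ffunP => x; rewrite !ffunE; apply/eqP; rewrite hf -blockE repK.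
  rewrite finset.inE => /injectiveP ginj -> x y.
  by rewrite !ffunE (inj_eq ginj) blockE.
rewrite finset.card_imset// card_inj_ffuns; congr falling_factorial.
by rewrite card_sig; apply: eq_card => B.
Qed.

(** Blocks are the fibres over image points; these are nonempty, so [fib] is injective on the
    image. *)
Lemma card_preim_partition (D T : finType) (f : D -> T) :
  #|preim_partition f (finset.setTfor D)|
    = #|finset.imset f (mem (finset.setTfor D))|.
Proof.
pose fib z := [set y in finset.setTfor D | z == f y]%SET.
rewrite -(@finset.card_in_imset _ _ fib).
  by rewrite -finset.imset_comp.
move=> _ _ /finset.imsetP[x _ ->] /finset.imsetP[y _ ->] /finset.setP/(_ x).
by rewrite !finset.inE eqxx /= => /esym/eqP.
Qed.

Lemma card_ffun_image (T : finType) (l k : nat) :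
  #|[set f : {ffun 'I_l -> T} |
      #|finset.imset f (mem (finset.setTfor 'I_l))| == k]%SET|
    = (stirling2 l k * #|T| ^_ k)%N.
Proof.
set Q := [pred Q : {set {set 'I_l}} |
  finset.partition Q (finset.setTfor 'I_l) & #|Q| == k].
pose ker (f : {ffun 'I_l -> T}) := preim_partition f (finset.setTfor 'I_l).
rewrite -sum1_card (partition_big ker Q) /=; last first.
  move=> f; rewrite finset.inE -card_preim_partition => ->.
  by rewrite finset.preim_partitionP.
rewrite (eq_bigr (fun=> #|T| ^_ k)); first by rewrite sum_nat_const.
move=> B /andP[hB /eqP Bk].
rewrite -Bk -(card_preim_partition_fiber _ T _ hB) -sum1_card.
apply: eq_bigl => f; rewrite !finset.inE -card_preim_partition.
by apply: andb_idl => /eqP <-.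
Qed.

(** A self-map of ['I_n] has an image of size [n] iff it is injective, so [card_ffun_image] reads n!
    = S(n,n) n!. *)
Lemma stirling2_diag (n : nat) : stirling2 n n = 1%N.
Proof.
have := card_ffun_image 'I_n n n; rewrite card_ord.
suff -> : #|[set f : {ffun 'I_n -> 'I_n} |
    #|finset.imset f (mem (finset.setTfor 'I_n))| == n]%SET| = n ^_ n.
  rewrite ffactnn => /esym/eqP; rewrite -[X in _ == X]mul1n eqn_pmul2r ?fact_gt0//.
  by move/eqP.
have := card_inj_ffuns 'I_n 'I_n; rewrite !card_ord => <-; apply: eq_card => f.
rewrite !finset.inE -[X in _ == X]card_ord -finset.cardsT.
apply/finset.imset_injP/injectiveP => [h x y|h x y _ _]; last exact: h.
by apply: h; rewrite finset.in_setT.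
Qed.

Lemma stirling2_0r (n : nat) : (0 < n)%N -> stirling2 n 0 = 0%N.
Proof.
move=> n0; have := card_ffun_image 'I_1 n 0; rewrite ffactn0 muln1 => <-.
apply: eq_card0 => f; rewrite finset.inE finset.cards_eq0.
apply/negP => /eqP/finset.setP/(_ (f (Ordinal n0))).
by rewrite finset.imset_f ?finset.in_setT// finset.in_set0.
Qed.

(** * Moments of a binomial sample *)

(** Independence in algebraic form: weight and indicator are both products over [i], so the sum
    factors, with factor [p] on [A] and [p + q = 1] elsewhere. *)
Lemma sum_bernoulli_subset (R : comNzRingType) (I : finType) (p q : R)
    (A : {set I}) : p + q = 1 ->
  \sum_(u : {ffun I -> bool})
      (\prod_i (if u i then p else q)) * (A \subset [pred i | u i])%:R
    = p ^+ #|A|.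
Proof.
move=> pq.
pose F i (b : bool) := (if b then p else q) * (if i \in A then b%:R else 1).
transitivity (\prod_i \sum_(b : bool) F i b).
  rewrite bigA_distr_bigA; apply: eq_bigr => u _; rewrite big_split /=.
  congr (_ * _); rewrite -big_mkcond /=.
  case: (boolP (A \subset _)) => [/fintype.subsetP sA|].
    by rewrite big1 ?mulr1n// => i /sA; rewrite inE => ->; rewrite mulr1n.
  case/subsetPn => i iA /negbTE ui.
  by rewrite (bigD1 i)//= -[u i]/(i \in [pred i | u i]) ui mul0r.
rewrite -prodr_const [RHS]big_mkcond; apply: eq_bigr => i _.
by rewrite big_bool /F; case: ifP => _ /=; rewrite ?mulr1 ?mulr0 ?addr0 ?pq.
Qed.

Lemma sum_bernoulli_expn (R : comNzRingType) (p q : R) (m l : nat) :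
  p + q = 1 ->
  \sum_(u : {ffun 'I_m -> bool})
      (\prod_i (if u i then p else q)) * #|[pred i | u i]|%:R ^+ l
    = \sum_(k < l.+1) (stirling2 l k)%:R * (m ^_ k)%:R * p ^+ k.
Proof.
move=> pq.
pose im (f : {ffun 'I_l -> 'I_m}) := finset.imset f (mem (finset.setTfor 'I_l)).
have exp_sum (u : {ffun 'I_m -> bool}) :
    #|[pred i | u i]|%:R ^+ l
    = \sum_(f : {ffun 'I_l -> 'I_m}) (im f \subset [pred i | u i])%:R :> R.
  rewrite -natrX -[X in (_ ^ X)%N](card_ord l) -card_ffun_on -sum1_card.
  rewrite natr_sum big_mkcond; apply: eq_bigr => f _.
  suff -> : (f \in ffun_on [pred i | u i]) = (im f \subset [pred i | u i]).
    by case: ifP.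
  apply/ffun_onP/fintype.subsetP => [h _ /finset.imsetP[x _ ->]|h x]; first exact: h.
  by apply: h; rewrite finset.imset_f ?finset.in_setT.
under eq_bigr do rewrite exp_sum mulr_sumr.
rewrite exchange_big /=; under eq_bigr do rewrite (sum_bernoulli_subset _ _ _ _ _ pq).
have im_lt f : (#|im f| < l.+1)%N.
  by rewrite ltnS (leq_trans (leq_imset_card _ _))// finset.cardsT card_ord.
rewrite (partition_big (fun f => Ordinal (im_lt f)) predT)//=.
apply: eq_bigr => k _.
rewrite (eq_bigr (fun=> p ^+ k)) => [|f /eqP <-//].
rewrite sumr_const -[LHS]mulr_natl; congr (_ * _).
have := card_ffun_image 'I_m l k; rewrite card_ord -natrM => <-.
by congr _%:R; apply: eq_card => f; rewrite finset.inE.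
Qed.

(** The conditional moment after one step from [w] white balls among [T]; the right-hand side has
    the unfolded shape of [gamma_coef] and [delta_coef]. *)
Lemma sum_bernoulli_affine (R : realType) (w T : R) (m c s : nat) :
  \sum_(u : {ffun 'I_m -> bool})
      (\prod_i (if u i then w / T else 1 - w / T)) *
      (w + c%:R * #|[pred i | u i]|%:R) ^+ s
    = (\sum_(0 <= l < s.+1)
         c%:R ^+ l * ('C(s, l)%:R * (m ^_ l)%:R / T ^+ l)) * w ^+ s +
      \sum_(2 <= j < s.+1) w ^+ (s + 1 - j) *
        \sum_(j <= l < s.+1)
          'C(s, l)%:R * c%:R ^+ l *
          ((stirling2 l (l + 1 - j))%:R * (m ^_ (l + 1 - j))%:R
           / T ^+ (l + 1 - j)).
Proof.
(* Here [l] indexes the binomial theorem and [k] the expansion of the [l]-th binomial moment; the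
   exponent of [w] collects [s - l] from the former and [k] from [(w / T) ^+ k]. *)
pose G l k : R := 'C(s, l)%:R * c%:R ^+ l *
  ((stirling2 l k)%:R * (m ^_ k)%:R / T ^+ k) * w ^+ (s - l + k).
transitivity (\sum_(0 <= l < s.+1) \sum_(0 <= k < l.+1) G l k).
  under eq_bigr do rewrite exprDn mulr_sumr.
  rewrite exchange_big /= big_mkord; apply: eq_bigr => l _.
  transitivity ('C(s, l)%:R * c%:R ^+ l * w ^+ (s - l) *
      \sum_(u : {ffun 'I_m -> bool}) (\prod_i (if u i then w / T else 1 - w / T)) *
      #|[pred i | u i]|%:R ^+ l).
    rewrite mulr_sumr; apply: eq_bigr => u _.
    rewrite exprMn -[_ *+ 'C(_, _)]mulr_natl; ring.
  rewrite sum_bernoulli_expn ?subrKC// mulr_sumr big_mkord.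
  apply: eq_bigr => k _; rewrite /G exprMn exprVn exprD; ring.
(* The term [k = l] feeds gamma. The others are indexed by [j = l + 1 - k]; for [l > 0] the term
   [k = 0] drops out because S(l,0) = 0. *)
have stepl l : \sum_(0 <= k < l.+1) G l k
    = G l l + \sum_(2 <= j < l.+1) G l (l + 1 - j)%N.
  rewrite big_nat_recr//= addrC; congr (_ + _).
  case: l => [|l]; first by rewrite !big_geq.
  rewrite big_ltn// {1}/G stirling2_0r// !mul0r mulr0 mul0r add0r.
  rewrite big_nat_rev [RHS]big_add1 /=; apply: eq_big_nat => i /andP[i1 il].
  by congr G; lia.
under eq_bigr do rewrite stepl.
rewrite big_split /=; congr (_ + _).
  rewrite mulr_suml; apply: eq_big_nat => l /andP[_ ls].
  rewrite /G stirling2_diag subnK//; ring.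
(* Padding the range of [j] to one independent of [l] lets the two sums over the triangle [j <= l]
   be exchanged. *)
transitivity (\sum_(0 <= l < s.+1)
    \sum_(2 <= j < s.+1 | (j < l.+1)%N) G l (l + 1 - j)%N).
  by apply: eq_big_nat => l /andP[_ ls]; rewrite (big_nat_widen _ _ s.+1).
rewrite (exchange_big_dep_nat predT)//=; apply: eq_big_nat => j /andP[j2 js].
rewrite mulr_sumr (big_nat_widenl j 0)//= big_nat_cond [RHS]big_nat_cond.
apply: eq_big => l; first by rewrite ltnS.
rewrite ltnS => /andP[/andP[_ ls] jl].
rewrite /G (_ : s - l + (l + 1 - j) = s + 1 - j)%N; last by lia.
ring.
Qed.

(** * Expectations as finite sums over colour histories *)

Lemma expectation_simple (R : realType) (d : measure_display)
    (Omega : measurableType d) (P : probability Omega R) (I : finType)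
    (A : I -> set Omega) (a : I -> R) :
  (forall i, measurable (A i)) ->
  'E_P[fun w => (\sum_i a i * \1_(A i) w)%R]%E = (\sum_i a i * fine (P (A i)))%:E.
Proof.
move=> mA; rewrite unlock.
under eq_integral do rewrite -sumEFin.
rewrite integral_sum//; last first.
  move=> i; under eq_fun do rewrite EFinM.
  by apply: integrableZl => //; exact: integrable_indic.
rewrite -sumEFin; apply: eq_bigr => i _.
under eq_integral do rewrite EFinM.
rewrite integralZl//; last exact: integrable_indic.
by rewrite integral_indic// setIT EFinM fineK// fin_num_measure.
Qed.

Lemma measurable_observed (R : realType) (d : measure_display)
    (Omega : measurableType d) (P : probability Omega R) (m : nat)
    (X : nat -> 'I_m -> {RV P >-> bool}) (e : nat -> 'I_m -> bool) (n : nat) :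
  measurable (observed X e n).
Proof.
rewrite (_ : observed X e n =
    \bigcap_(j in `I_n) \bigcap_(i in [set: 'I_m]) (X j i @^-1` [set e j i])).
  apply: fin_bigcap_measurable => // j _.
  apply: fin_bigcap_measurable => // i _.
  exact: measurable_funPTI.
by apply/seteqP; split => w /= h j; [move=> jn i _|move=> i jn]; apply: h.
Qed.

(* Only the rows j < n are meaningful; the others are filled with [false]. *)
Definition history (m n : nat) (t : {ffun 'I_n -> {ffun 'I_m -> bool}}) :
    nat -> 'I_m -> bool :=
  fun j i => if insub j is Some k then t k i else false.

(* Row n is u; so are the later rows, which play no role. *)
Definition extend (m : nat) (e : nat -> 'I_m -> bool) (n : nat)
    (u : {ffun 'I_m -> bool}) : nat -> 'I_m -> bool :=
  fun j i => if (j < n)%N then e j i else u i.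

Lemma history_ord (m n : nat) (t : {ffun 'I_n -> {ffun 'I_m -> bool}})
    (k : 'I_n) (i : 'I_m) : history m n t k i = t k i.
Proof. by rewrite /history valK. Qed.

Lemma eq_white (m c W0 n : nat) (e e' : nat -> 'I_m -> bool) :
  (forall j i, (j < n)%N -> e j i = e' j i) ->
  white c W0 e n = white c W0 e' n.
Proof.
elim: n => //= n IHn ee'; rewrite IHn => [|j i jn]; last by rewrite ee'// ltnW.
by congr (_ + _ * _)%N; apply: eq_card => i; rewrite !inE ee'.
Qed.

Lemma white_extend (m c W0 n : nat) (e : nat -> 'I_m -> bool)
    (u : {ffun 'I_m -> bool}) :
  white c W0 (extend m e n u) n.+1 = (white c W0 e n + c * #|[pred i | u i]|)%N.
Proof.
rewrite /= (eq_white _ _ _ _ _ e) => [|j i jn]; last by rewrite /extend jn.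
by congr (_ + _ * _)%N; apply: eq_card => i; rewrite !inE /extend ltnn.
Qed.

Lemma white_black (m c W0 B0 n : nat) (e : nat -> 'I_m -> bool) :
  (white c W0 e n + black c B0 e n)%N = (W0 + B0 + n * m * c)%N.
Proof.
elim: n => [|n IHn] /=; first by rewrite addn0.
rewrite addnACA IHn -mulnDr -addnA; congr (_ + _)%N.
have -> : (#|[pred i | e n i]| + #|[pred i | ~~ e n i]| = m)%N.
  by rewrite cardC card_ord.
by rewrite mulSn mulnDl addnC (mulnC c).
Qed.

Lemma draw_probE (R : realType) (m c W0 B0 n : nat) (e : nat -> 'I_m -> bool)
    (b : bool) : (0 < W0 + B0)%N ->
  draw_prob R c W0 B0 e n b =
    let p := (white c W0 e n)%:R / total_balls R m c (W0 + B0) n in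
    if b then p else 1 - p.
Proof.
move=> T0; rewrite /draw_prob /total_balls /=.
have Tn0 : (white c W0 e n + black c B0 e n)%:R != 0 :> R.
  by rewrite white_black pnatr_eq0 -lt0n addn_gt0 T0.
rewrite -(white_black m c W0 B0 n e); case: b => //.
rewrite natrD in Tn0 *; field.
exact: Tn0.
Qed.

(** Consequently the events of the histories of length [n] partition the sample space. *)
Lemma observed_history (R : realType) (d : measure_display)
    (Omega : measurableType d) (P : probability Omega R) (m n : nat)
    (X : nat -> 'I_m -> {RV P >-> bool})
    (t : {ffun 'I_n -> {ffun 'I_m -> bool}}) (w : Omega) :
  observed X (history m n t) n w <-> t = [ffun k : 'I_n => [ffun i => X k i w]].
Proof.
split=> [h|-> j i jn].
  by apply/ffunP => k; rewrite ffunE; apply/ffunP => i; rewrite ffunE h ?history_ord.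
by rewrite -[j]/(val (Ordinal jn)) history_ord !ffunE.
Qed.

Lemma observed_extend (R : realType) (d : measure_display)
    (Omega : measurableType d) (P : probability Omega R) (m n : nat)
    (X : nat -> 'I_m -> {RV P >-> bool}) (e : nat -> 'I_m -> bool)
    (u : {ffun 'I_m -> bool}) (w : Omega) :
  observed X (extend m e n u) n.+1 w <->
    observed X e n w /\ u = [ffun i => X n i w].
Proof.
split=> [h|[h ->] j i].
  split=> [j i jn|]; first by rewrite h 1?ltnW// /extend jn.
  by apply/ffunP => i; rewrite ffunE h// /extend ltnn.
rewrite ltnS leq_eqVlt /extend => /predU1P[->|jn]; first by rewrite ltnn ffunE.
by rewrite jn h.
Qed.

(** W_n is constant on each of the finitely many history events, so integrals reduce to finite
    sums. *)
Lemma expectation_history (R : realType) (d : measure_display)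
    (Omega : measurableType d) (P : probability Omega R) (m c W0 n : nat)
    (X : nat -> 'I_m -> {RV P >-> bool}) (f : R -> R) :
  'E_P[fun w => f (nb_white c W0 X n w)]%E =
    (\sum_(t : {ffun 'I_n -> {ffun 'I_m -> bool}})
       f (white c W0 (history m n t) n)%:R *
       fine (P (observed X (history m n t) n)))%:E.
Proof.
rewrite -expectation_simple => [|t]; last exact: measurable_observed.
congr expectation; apply/funext => w.
(* The history realised at [w] is the only one whose indicator survives there. *)
set t0 := [ffun k : 'I_n => [ffun i => X k i w]].
rewrite (bigD1 t0)//= big1 => [|t tt0]; last first.
  by rewrite indicE memNset ?mulr0// => /observed_history /eqP; apply/negP.
rewrite indicE mem_set ?mulr1 ?addr0; last exact/observed_history.
congr (f _%:R); apply: eq_white => j i jn.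
by rewrite -[j in RHS]/(val (Ordinal jn)) history_ord !ffunE.
Qed.

(** Tower property: on each history the sum over [u] is the conditional expectation given the first
    [n] steps. *)
Lemma expectation_next (R : realType) (d : measure_display)
    (Omega : measurableType d) (P : probability Omega R) (m c W0 B0 n : nat)
    (X : nat -> 'I_m -> {RV P >-> bool}) (f : R -> R) :
  (0 < W0 + B0)%N -> urn_model_R c W0 B0 X ->
  'E_P[fun w => f (nb_white c W0 X n.+1 w)]%E =
  'E_P[fun w => (\sum_(u : {ffun 'I_m -> bool})
     (\prod_i (if u i then nb_white c W0 X n w / total_balls R m c (W0 + B0) n
        else 1 - nb_white c W0 X n w / total_balls R m c (W0 + B0) n)) *
     f (nb_white c W0 X n w + c%:R * #|[pred i | u i]|%:R))%R]%E.
Proof.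
move=> T0 hX; set T := total_balls _ _ _ _ _.
pose Q x := \sum_(u : {ffun 'I_m -> bool})
  (\prod_i (if u i then x / T else 1 - x / T)) * f (x + c%:R * #|[pred i | u i]|%:R).
rewrite (expectation_history _ _ _ _ m c W0 n X Q).
pose I := ({ffun 'I_n -> {ffun 'I_m -> bool}} * {ffun 'I_m -> bool})%type.
pose ext (tu : I) := extend m (history m n tu.1) n tu.2.
(* The left side is expanded over pairs of a history of length [n] and a next row, to which the
   one-step law of the model applies. *)
transitivity ('E_P[fun w => (\sum_(tu : I)
    f (white c W0 (ext tu) n.+1)%:R * \1_(observed X (ext tu) n.+1) w)%R])%E.
  congr expectation; apply/funext => w.
  set t0 : I := ([ffun k : 'I_n => [ffun i => X k i w]], [ffun i => X n i w]).
  rewrite (bigD1 t0)//= big1 => [|[t u] tt0]; last first.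
    rewrite indicE memNset ?mulr0// => /observed_extend[/observed_history /= tE /= uE].
    by move: tt0; rewrite tE uE eqxx.
  rewrite indicE mem_set ?mulr1 ?addr0; last first.
    by apply/observed_extend; split=> //; exact/observed_history.
  congr (f _%:R); apply: eq_white => j i; rewrite /ext /extend ltnS leq_eqVlt.
  case/predU1P => [->|jn]; first by rewrite ltnn ffunE.
  by rewrite jn -[j in RHS]/(val (Ordinal jn)) history_ord !ffunE.
rewrite expectation_simple; last by move=> tu; exact: measurable_observed.
rewrite -(pair_bigA _ (fun t u => f (white c W0 (ext (t, u)) n.+1)%:R *
  fine (P (observed X (ext (t, u)) n.+1)))).
congr EFin; apply: eq_bigr => t _; rewrite mulr_suml; apply: eq_bigr => u _.
set e := history m n t; rewrite -[ext (t, u)]/(extend m e n u).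
have extE j i : (j < n)%N -> extend m e n u j i = e j i by rewrite /extend => ->.
(* The extended table agrees with [e] on the first [n] rows, so the conditioning event and the
   composition are those of [e], while the new row is [u]. *)
have -> : P (observed X (extend m e n u) n.+1) = (P (observed X e n) *
    (\prod_i (if u i then (white c W0 e n)%:R / T
               else 1 - (white c W0 e n)%:R / T))%:E)%E.
  rewrite hX (_ : observed X (extend m e n u) n = observed X e n); last first.
    by apply/seteqP; split=> w h j i jn; rewrite h// extE.
  congr (_ * EFin _)%E; apply: eq_bigr => i _.
  by rewrite draw_probE//= (eq_white _ _ _ _ _ _ extE) /extend ltnn.
rewrite fineM ?fin_num_measure//; last exact: measurable_observed.
rewrite white_extend natrD natrM /=; ring.
Qed.

(** * Moment recurrence and variance *)

Lemma moment_fineK (R : realType) (d : measure_display)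
    (Omega : measurableType d) (P : probability Omega R) (m c W0 n s : nat)
    (X : nat -> 'I_m -> {RV P >-> bool}) :
  moment P (nb_white c W0 X n) s = (fine (moment P (nb_white c W0 X n) s))%:E.
Proof.
by rewrite /moment (expectation_history _ _ _ _ m c W0 n X (fun x => x ^+ s)).
Qed.

Lemma moment0 (R : realType) (d : measure_display)
    (Omega : measurableType d) (P : probability Omega R) (m c W0 s : nat)
    (X : nat -> 'I_m -> {RV P >-> bool}) :
  moment P (nb_white c W0 X 0) s = (W0%:R ^+ s)%:E.
Proof. by rewrite -(expectation_cst P). Qed.

(** By [sum_bernoulli_affine] the conditional moment is a polynomial in W_n whose coefficients do
    not depend on the history; linearity turns its powers into moments. *)
Lemma moment_next (R : realType) (d : measure_display)
    (Omega : measurableType d) (P : probability Omega R) (m c W0 B0 n s : nat)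
    (X : nat -> 'I_m -> {RV P >-> bool}) :
  (0 < W0 + B0)%N -> urn_model_R c W0 B0 X ->
  let M k := fine (moment P (nb_white c W0 X n) k) in
  moment P (nb_white c W0 X n.+1) s =
    (gamma_coef R m c (W0 + B0) n s * M s
     + delta_coef m c (W0 + B0) n s M)%:E.
Proof.
move=> T0 hX M; set g := gamma_coef _ _ _ _ _ _.
rewrite /moment (expectation_next _ _ _ _ m c W0 B0 n X (fun x => x ^+ s))//.
under eq_fun do rewrite sum_bernoulli_affine -/(gamma_coef R m c (W0 + B0) n s) -/g.
pose h j : R := \sum_(j <= l < s.+1) 'C(s, l)%:R * c%:R ^+ l *
  ((stirling2 l (l + 1 - j))%:R * (m ^_ (l + 1 - j))%:R
   / total_balls R m c (W0 + B0) n ^+ (l + 1 - j)).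
rewrite (expectation_history _ _ _ _ m c W0 n X
  (fun x => g * x ^+ s + \sum_(2 <= j < s.+1) x ^+ (s + 1 - j) * h j)).
have ME k : M k = \sum_(t : {ffun 'I_n -> {ffun 'I_m -> bool}})
    (white c W0 (history m n t) n)%:R ^+ k *
    fine (P (observed X (history m n t) n)).
  by rewrite /M /moment (expectation_history _ _ _ _ m c W0 n X (fun x => x ^+ k)).
congr EFin; under eq_bigr do rewrite mulrDl.
rewrite big_split /=; congr (_ + _).
  by rewrite ME mulr_sumr; apply: eq_bigr => t _; rewrite mulrA.
under eq_bigr do rewrite mulr_suml.
rewrite exchange_big /=; apply: eq_bigr => j _.
by rewrite ME mulr_suml; apply: eq_bigr => t _; rewrite mulrAC.
Qed.

Lemma variance_nb_white (R : realType) (d : measure_display)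
    (Omega : measurableType d) (P : probability Omega R) (m c W0 n : nat)
    (X : nat -> 'I_m -> {RV P >-> bool}) :
  let W := nb_white c W0 X n in
  'V_P[W]%E = (moment P W 2 - 'E_P[W] ^+ 2)%E.
Proof.
move=> W; rewrite /variance covariance.unlock /moment.
have EW := expectation_history _ _ _ P m c W0 n X.
set a := fine 'E_P[W]%E.
rewrite (EW id) (EW (fun x => x ^+ 2)) (EW (fun x => (x - a) * (x - a))).
(* Applied to the constant 1, the history formula says that the history probabilities sum to 1. *)
have := EW (fun=> 1); rewrite (expectation_cst P 1) => -[].
under eq_bigr do rewrite mul1r.
pose p t := fine (P (observed X (history m n t) n)); move=> /esym p1.
have aE : a = \sum_t (white c W0 (history m n t) n)%:R * p t by rewrite /a (EW id).
rewrite -aE expe2 -EFinM -EFinB; congr EFin.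
transitivity (\sum_t (white c W0 (history m n t) n)%:R ^+ 2 * p t
   - a * (\sum_t (white c W0 (history m n t) n)%:R * p t) *+ 2
   + a * a * \sum_t p t).
  rewrite !mulr_sumr -sumrMnl -sumrN -!big_split /=.
  by apply: eq_bigr => t _; rewrite /p; ring.
by rewrite -aE p1 /p; ring.
Qed.

(** * Solving the recurrence; coefficients of orders one and two *)

(** Variation of constants: the quotient of [a n] by the product of the [g j] with [j < n] grows at
    each step by [b n] over the next product. *)
Lemma affine_recurrence (F : fieldType) (a g b : nat -> F) :
  (forall n, g n != 0) -> (forall n, a n.+1 = g n * a n + b n) ->
  forall n, a n = (\prod_(0 <= j < n) g j) *
    (a 0 + \sum_(0 <= l < n) b l / \prod_(0 <= j < l.+1) g j).
Proof.
move=> g0 ag; elim=> [|n IHn]; first by rewrite !big_geq// addr0 mul1r.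
have gn0 k : \prod_(0 <= j < k) g j != 0.
  by rewrite prodf_seq_neq0; apply/allP => j _; rewrite /= g0.
rewrite ag IHn !(big_nat_recr n)//=; field.
by rewrite gn0 g0.
Qed.

(** The term [l = 0] is 1 and the others are nonnegative; this permits division by products of
    gammas. *)
Lemma gamma_coef_gt0 (R : realType) (m c T0 n s : nat) :
  0 < gamma_coef R m c T0 n s.
Proof.
rewrite /gamma_coef big_ltn// bin0 ffactn0 !expr0 divr1 !mul1r ltr_wpDr//.
by apply: sumr_ge0 => l _; rewrite !mulr_ge0 ?invr_ge0 ?exprn_ge0// /total_balls.
Qed.

Lemma stirling2_1r (n : nat) : (0 < n)%N -> stirling2 n 1 = 1%N.
Proof.
move=> n0; have := card_ffun_image 'I_1 n 1; rewrite card_ord muln1 => <-.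
transitivity #|{ffun 'I_n -> 'I_1}|; last by rewrite card_ffun !card_ord exp1n.
apply: eq_card => f; rewrite finset.inE [RHS]inE eqn_leq.
rewrite (leq_trans (max_card _)) ?card_ord//= lt0n finset.cards_eq0.
apply/finset.set0Pn; exists (f (Ordinal n0)).
by rewrite finset.imset_f ?finset.in_setT.
Qed.

(** Read backwards, the falling factorial of [n - 1 + x] is the rising factorial of [x], indexed
    like the product of gammas. *)
Lemma binr_rising (R : realType) (x : R) (n : nat) :
  binr (n%:R - 1 + x) n = (\prod_(0 <= j < n) (x + j%:R)) / n`!%:R.
Proof.
rewrite /binr big_nat_rev big_mkord; congr (_ / _); apply: eq_bigr => i _.
by rewrite add0n natrB -1?natr1//; ring.
Qed.

Lemma gamma_coef1 (R : realType) (m c T0 n : nat) :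
  gamma_coef R m c T0 n 1 = 1 + c%:R * m%:R / total_balls R m c T0 n.
Proof.
rewrite /gamma_coef !big_nat_recr//= big_geq// bin0 binn ffactn0 ffactn1.
by rewrite !expr1 !expr0 divr1; ring.
Qed.

(** Scaled by mc, the factors in the numerator are T_n + mc + c sqrt m and T_n + mc - c sqrt m,
    whose product is a difference of squares; the base of the denominator becomes T_n. *)
Lemma gamma_coef2 (R : realType) (m c T0 n : nat) :
  (0 < m)%N -> (0 < c)%N -> (0 < T0)%N ->
  gamma_coef R m c T0 n 2 =
    (mu1 R m c T0 + n%:R) * (mu2 R m c T0 + n%:R)
      / (T0%:R / (m%:R * c%:R) + n%:R) ^+ 2.
Proof.
move=> m0 c0 T00.
have Tn0 : total_balls R m c T0 n != 0 by rewrite pnatr_eq0 -lt0n addn_gt0 T00.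
have mn0 : m%:R != 0 :> R by rewrite pnatr_eq0 -lt0n.
have cn0 : c%:R != 0 :> R by rewrite pnatr_eq0 -lt0n.
rewrite /gamma_coef !big_nat_recr//= big_geq// bin0 bin1 binn.
rewrite ffactn0 ffactn1 (_ : (m ^_ 2)%:R = m%:R * (m%:R - 1) :> R); last first.
  by case: m m0 {Tn0 mn0} => // k _; rewrite ffactnS ffactn1 natrM /= -natr1 addrK.
have sq : Num.sqrt m%:R * Num.sqrt m%:R = m%:R :> R.
  by rewrite -expr2 sqr_sqrtr ?ler0n.
move: Tn0; rewrite /mu1 /mu2 /total_balls !natrD !natrM => Tn0.
(* The square of the root is kept as a product: [sq] is used only on the gamma side, and the other
   equality is a rational identity in the root. *)
transitivity (((T0%:R + n%:R * m%:R * c%:R + m%:R * c%:R) ^+ 2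
    - c%:R ^+ 2 * (Num.sqrt m%:R * Num.sqrt m%:R))
  / (T0%:R + n%:R * m%:R * c%:R) ^+ 2 : R).
  by rewrite sq; field.
field.
by rewrite mn0 cn0 mulrA Tn0.
Qed.

Lemma delta_coef1 (R : realType) (m c T0 n : nat) (M : nat -> R) :
  delta_coef m c T0 n 1 M = 0.
Proof. by rewrite /delta_coef big_geq. Qed.

Lemma delta_coef2 (R : realType) (m c T0 n : nat) (M : nat -> R) :
  delta_coef m c T0 n 2 M = M 1 * (c%:R ^+ 2 * m%:R / total_balls R m c T0 n).
Proof.
rewrite /delta_coef big_nat1 big_nat1 stirling2_1r// binn ffactn1 expr1.
by rewrite !mul1r mulrA.
Qed.

(** * Closed forms for the moments *)

(** For order one, delta vanishes and gamma is T_{n+1} / T_n, so the mean stays proportional to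
    T_n. *)
Lemma mean_nb_white (R : realType) (d : measure_display)
    (Omega : measurableType d) (P : probability Omega R) (m c W0 B0 n : nat)
    (X : nat -> 'I_m -> {RV P >-> bool}) :
  (0 < W0 + B0)%N -> urn_model_R c W0 B0 X ->
  moment P (nb_white c W0 X n) 1 =
    (W0%:R / (W0 + B0)%:R * total_balls R m c (W0 + B0) n)%:E.
Proof.
move=> T0 hX.
have T0n0 : (W0 + B0)%:R != 0 :> R by rewrite pnatr_eq0 -lt0n.
elim: n => [|n IHn]; first by rewrite moment0 expr1 /total_balls addn0 divfK.
rewrite (moment_next _ _ _ _ m c W0 B0)//= IHn delta_coef1 gamma_coef1 addr0.
congr EFin; have : total_balls R m c (W0 + B0) n != 0.
  by rewrite pnatr_eq0 -lt0n addn_gt0 T0.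
rewrite /total_balls !natrD !natrM -natr1 in T0n0 * => Tn0.
by rewrite /=; field; rewrite Tn0 T0n0.
Qed.

Lemma moment_nb_white (R : realType) (d : measure_display)
    (Omega : measurableType d) (P : probability Omega R) (m c W0 B0 n s : nat)
    (X : nat -> 'I_m -> {RV P >-> bool}) :
  (0 < W0 + B0)%N -> urn_model_R c W0 B0 X ->
  let gamma j := gamma_coef R m c (W0 + B0) j s in
  let delta j := delta_coef m c (W0 + B0) j s
    (fun k => fine (moment P (nb_white c W0 X j) k)) in
  moment P (nb_white c W0 X n) s =
    ((\prod_(0 <= j < n) gamma j) *
     (W0%:R ^+ s +
        \sum_(0 <= l < n) delta l / \prod_(0 <= j < l.+1) gamma j))%:E.
Proof.
move=> T0 hX gamma delta; rewrite moment_fineK; congr EFin.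
pose a k := fine (moment P (nb_white c W0 X k) s).
rewrite -/(a n) (affine_recurrence _ a gamma delta).
- by rewrite /a moment0.
- by move=> k; rewrite lt0r_neq0// gamma_coef_gt0.
- by move=> k; rewrite /a (moment_next _ _ _ _ m c W0 B0).
Qed.

Theorem theorem4 (R : realType) (d : measure_display)
    (Omega : measurableType d) (P : probability Omega R)
    (m c W0 B0 : nat) (X : nat -> 'I_m -> {RV P >-> bool})
    (hm : (1 <= m)%N) (hc : (1 <= c)%N) (hW0 : (0 < W0)%N) (hB0 : (0 < B0)%N)
    (hT0 : (m <= W0 + B0)%N) (hX : urn_model_R c W0 B0 X) :
  let T0 := (W0 + B0)%N in
  let W := nb_white c W0 X in
  let tau : R := T0%:R / (m%:R * c%:R) in
  let mu1 := mu1 R m c T0 in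
  let mu2 := mu2 R m c T0 in
  let gamma n s := gamma_coef R m c T0 n s in
  let delta n s := delta_coef m c T0 n s (fun k => fine (moment P (W n) k)) in
  forall n : nat,
    [/\ 'E_P[W n]%E = (W0%:R / T0%:R * (n%:R * m%:R * c%:R + T0%:R))%:E,
        'V_P[W n]%E = (moment P (W n) 2 - 'E_P[W n] ^+ 2)%E,
        moment P (W n) 2 =
          (binr (n%:R - 1 + mu1) n * binr (n%:R - 1 + mu2) n
             / binr (n%:R - 1 + tau) n ^+ 2 *
           (W0%:R ^+ 2 + W0%:R * c%:R ^+ 2 * m%:R / T0%:R *
              \sum_(0 <= l < n)
                 binr (l%:R + tau) l.+1 ^+ 2
                 / (binr (l%:R + mu1) l.+1 * binr (l%:R + mu2) l.+1)))%:E
      & forall s : nat, (1 <= s)%N ->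
          moment P (W n) s =
            ((\prod_(0 <= j < n) gamma j s) *
             (W0%:R ^+ s + \sum_(0 <= l < n)
                delta l s / \prod_(0 <= j < l.+1) gamma j s))%:E].
Proof.
move=> T0 W tau mu1' mu2' gamma delta n.
have T0_gt0 : (0 < T0)%N by rewrite addn_gt0 hW0.
have T0n0 : T0%:R != 0 :> R by rewrite pnatr_eq0 -lt0n.
(* The factorials cancel between numerator and denominator, leaving the product of the factored
   gammas. *)
have binr_gamma k : binr (k%:R - 1 + mu1') k * binr (k%:R - 1 + mu2') k
    / binr (k%:R - 1 + tau) k ^+ 2 = \prod_(0 <= j < k) gamma j 2.
  under eq_bigr do rewrite /gamma gamma_coef2//.
  rewrite !big_split /= prodfV prodrXl !binr_rising.
  have k0 : k`!%:R != 0 :> R by rewrite pnatr_eq0 -lt0n fact_gt0.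
  have t0 : \prod_(0 <= j < k) (tau + j%:R) != 0.
    rewrite prodf_seq_neq0; apply/allP => j _ /=.
    by rewrite lt0r_neq0// ltr_wpDr// divr_gt0 ?mulr_gt0 ?ltr0n.
  by field; rewrite k0 t0.
have mean k : moment P (W k) 1 = (W0%:R / T0%:R * total_balls R m c T0 k)%:E.
  exact: mean_nb_white.
split.
- transitivity (moment P (W n) 1); first by congr expectation.
  by rewrite mean /total_balls natrD !natrM addrC.
- exact: variance_nb_white.
- rewrite (moment_nb_white _ _ _ _ m c W0 B0)// -binr_gamma mulr_sumr.
  congr (_ * (_ + _))%:E; apply: eq_bigr => l _.
  (* Writing [l] as [l.+1 - 1] gives both sides the same binomials, those of [binr_gamma] at
     [l.+1]. *)
  rewrite -binr_gamma (_ : l%:R = l.+1%:R - 1 :> R); last by rewrite -natr1 addrK.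
  (* Here delta is E(W_l) c^2 m / T_l; the mean is proportional to T_l, which cancels and leaves the
     constant W_0 c^2 m / T_0. *)
  rewrite delta_coef2 mean invf_div; congr (_ * _) => /=.
  have Tn0 : T0%:R + l%:R * m%:R * c%:R != 0 :> R.
    by rewrite -!natrM -natrD pnatr_eq0 -lt0n addn_gt0 T0_gt0.
  by rewrite -/T0; field; rewrite T0n0 Tn0.
- by move=> s _; exact: moment_nb_white.
Qed.
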